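(* Let $(G,\tau)$ be a locally quasi-convex locally minimal topological abelian group. Then $(G,\tau)$ can be embedded (as a topological subgroup) into a complete locally quasi-convex topological abelian group $A$ such that $A$ has a compact subgroup $B$ for which $A/B$ is UFSS and $N:=G\cap B$ is a minimal subgroup of $G$. In particular, $A$ is an almost minimal group.
   Context: Let $\mathbb{T}=\mathbb{R}/\mathbb{Z}$, $q:\mathbb{R}\to\mathbb{T}$ the canonical projection and $\mathbb{T}_+=q([-1/4,1/4])$. For a topological abelian group $G$, $G^\wedge$ is the group of continuous homomorphisms $G\to\mathbb{T}$. A subset $A\subseteq G$ is quasi-convex if for every $x\in G\setminus A$ there is $\chi\in G^\wedge$ with $\chi(A)\subseteq\mathbb{T}_+$ and $\chi(x)\notin\mathbb{T}_+$. A topological abelian group is locally quasi-convex if it has a basis of neighborhoods of $0$ consisting of quasi-convex sets. A Hausdorff topological group $(G,\tau)$ is minimal if there is no Hausdorff group topology on $G$ strictly coarser than $\tau$; it is locally minimal if there exists a neighborhood $V$ of $0$ such that whenever $\sigma\subseteq\tau$ is a Hausdorff group topology on $G$ for which $V$ is a $\sigma$-neighborhood of $0$, then $\sigma=\tau$. Subgroups carry the subspace topology, and a minimal subgroup is a subgroup that is minimal as a topological group. For a symmetric subset $U\ni 0$ of an abelian group $G$ and $n\ge1$, $(1/n)U:=\{x\in G: kx\in U\ \forall k\in\{1,\dots,n\}\}$. A Hausdorff topological group is UFSS if for some symmetric neighborhood $U$ of $0$ the sets $(1/n)U$, $n\ge 1$, form a neighborhood basis at $0$. A topological group is almost minimal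 if it has a closed normal subgroup $M$ which is minimal such that the quotient group by $M$ is UFSS. Complete means complete in the natural group uniformity. *)

(* Defs.v *)
From HB Require Import structures.
From mathcomp Require Import all_boot all_order all_algebra.
From mathcomp Require Import all_classical all_reals all_analysis.

Set Implicit Arguments.
Unset Strict Implicit.
Unset Printing Implicit Defensive.

Import Order.TTheory GRing.Theory Num.Theory.
Import numFieldTopology.Exports numFieldNormedType.Exports.

Local Open Scope classical_set_scope.
Local Open Scope ring_scope.

(* Topological abelian groups are topologicalZmodType's.  The library does not
   make them Hausdorff, so the Hausdorff condition is always explicit below. *)

Section Subgroup.
Variables (G : topologicalZmodType) (B : zmodClosed G).

Definition subgroup_type : Type := {x : G | x \in B}.

HB.instance Definition _ := SubChoice.on subgroup_type.
HB.instance Definition _ := [SubChoice_isSubZmodule of subgroup_type by <:].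
HB.instance Definition _ := Topological.copy subgroup_type
  (initial_topology (val : subgroup_type -> G)).

Fact subgroup_val_continuous : continuous (val : subgroup_type -> G).
Proof. exact: initial_continuous. Qed.

Fact subgroup_sub_continuous :
  continuous (fun x : subgroup_type * subgroup_type => x.1 - x.2).
Proof.
apply/continuousP => _ [U oU <-].
pose g (x : subgroup_type * subgroup_type) : G := val x.1 - val x.2.
have -> : (fun x : subgroup_type * subgroup_type => x.1 - x.2) @^-1`
    (val @^-1` U) = g @^-1` U.
  by apply/funext => x; rewrite /preimage /mkset /g raddfB.
suff /continuousP : continuous g by exact.
move=> x.
apply: (@continuous_comp _ (G * G)%type _
  (fun x : subgroup_type * subgroup_type => (val x.1, val x.2))
  (fun x : G * G => x.1 - x.2)); last exact: sub_continuous.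
apply: cvg_pair.
- by apply: continuous_comp; [exact: cvg_fst|exact: subgroup_val_continuous].
- by apply: continuous_comp; [exact: cvg_snd|exact: subgroup_val_continuous].
Qed.

HB.instance Definition _ :=
  PreTopologicalNmodule_isTopologicalZmodule.Build subgroup_type
    subgroup_sub_continuous.

End Subgroup.

Section PreimageSubgroup.
Variables (G A : zmodType) (f : {additive G -> A}) (B : zmodClosed A).

Definition preim_pred : pred G := [pred x | f x \in B].

Fact preim_zmod_closed : zmod_closed preim_pred.
Proof.
split => [|x y]; first by rewrite inE raddf0 rpred0.
by rewrite !inE raddfB => fx fy; rewrite rpredB.
Qed.

HB.instance Definition _ :=
  GRing.isZmodClosed.Build G preim_pred preim_zmod_closed.

Definition preim_subgroup : zmodClosed G :=
  GRing.ZmodClosed.clone G preim_pred _.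

End PreimageSubgroup.

Section QuotientGroup.
Variables (G : topologicalZmodType) (B : zmodClosed G).

Definition quotient_group : Type := quotient_topology (Quotient.quot B).

HB.instance Definition _ := Topological.copy quotient_group
  (quotient_topology (Quotient.quot B)).
HB.instance Definition _ := GRing.isZmodule.Build quotient_group
  (@Quotient.addqA G B) (@Quotient.addqC G B)
  (@Quotient.add0q G B) (@Quotient.addNq G B).

Definition quotient_proj (x : G) : quotient_group :=
  (\pi_(Quotient.quot B) x)%qT.

Fact quotient_projB x y :
  quotient_proj (x - y) = quotient_proj x - quotient_proj y.
Proof. exact: (raddfB (\pi_(Quotient.quot B)%qT)). Qed.

Fact quotient_projP (z : quotient_group) : exists x, quotient_proj x = z.
Proof. by exists (repr (z : Quotient.quot B)); exact: reprK. Qed.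

Fact quotient_proj_eq x y : quotient_proj x = quotient_proj y -> x - y \in B.
Proof. by move=> xy; rewrite Quotient.idealrBE; apply/eqP; exact: xy. Qed.

Fact quotient_proj_eq0 x y : x - y \in B -> quotient_proj x = quotient_proj y.
Proof. by rewrite Quotient.idealrBE => /eqP xy; exact: xy. Qed.

Fact quotient_proj_open (U : set G) : open U -> open (quotient_proj @` U).
Proof.
move=> oU.
suff : open (\bigcup_(b in [set b | b \in B]) [set x : G | U (x + b)]).
  congr (open _); apply/seteqP; split => x /=.
    move=> [b /= Bb Ub]; exists (x + b) => //.
    by apply: quotient_proj_eq0; rewrite addrC addKr.
  move=> [u Uu /quotient_proj_eq ux]; exists (u - x) => //=.
  by rewrite addrC subrK.
apply: bigcup_open => b _.
have /continuousP : continuous (fun x : G => x + b); last exact.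
move=> x; apply: (@continuous_comp _ (G * G)%type _ (fun x : G => (x, b))
  (fun x : G * G => x.1 + x.2)); last exact: add_continuous.
by apply: cvg_pair; [exact: cvg_id|exact: cvg_cst].
Qed.

Fact quotient_sub_continuous :
  continuous (fun x : quotient_group * quotient_group => x.1 - x.2).
Proof.
move=> [z w]; have [x <-] := quotient_projP z; have [y <-] := quotient_projP w.
move=> W Wxy; have [V [oV Vxy] VW] :
    exists2 V, open_nbhs (quotient_proj (x - y)) V & V `<=` W.
  have : nbhs (quotient_proj (x - y)) W by rewrite quotient_projB; exact: Wxy.
  by rewrite nbhsE.
have /= : nbhs (x - y) (quotient_proj @^-1` V).
  by apply: open_nbhs_nbhs; split.
move=> /(@sub_continuous G (x, y)) [[/= P Q] [/= Px Qy]] PQ.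
have [P' [oP' P'x] P'P] : exists2 P', open_nbhs x P' & P' `<=` P.
  by move: Px; rewrite nbhsE.
have [Q' [oQ' Q'y] Q'Q] : exists2 Q', open_nbhs y Q' & Q' `<=` Q.
  by move: Qy; rewrite nbhsE.
have nP : nbhs (quotient_proj x) (quotient_proj @` P').
  by apply: open_nbhs_nbhs; split; [exact: quotient_proj_open|exists x].
have nQ : nbhs (quotient_proj y) (quotient_proj @` Q').
  by apply: open_nbhs_nbhs; split; [exact: quotient_proj_open|exists y].
apply: (@filterS _ _ _
  ((quotient_proj @` P') `*` (quotient_proj @` Q'))); last first.
  by exists (quotient_proj @` P', quotient_proj @` Q').
move=> [_ _] [/= [p P'p <-] [q Q'q <-]]; apply: VW.
rewrite -quotient_projB; apply: (PQ (p, q)); split => /=.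
- exact: P'P.
- exact: Q'Q.
Qed.

HB.instance Definition _ :=
  PreTopologicalNmodule_isTopologicalZmodule.Build quotient_group
    quotient_sub_continuous.

End QuotientGroup.

Section Circle.
Variable R : realType.

Definition int_pred : pred R^o := [pred x : R | x \is a Num.int].

Fact int_zmod_closed : zmod_closed int_pred.
Proof. by split=> [|x y]; rewrite !inE; [exact: rpred0|exact: rpredB]. Qed.

HB.instance Definition _ :=
  GRing.isZmodClosed.Build R^o int_pred int_zmod_closed.

Definition integers : zmodClosed R^o := GRing.ZmodClosed.clone R^o int_pred _.

Definition circle : Type := quotient_group integers.

HB.instance Definition _ := TopologicalZmodule.on circle.

(* T_+, the image of [-1/4, 1/4] in T = R/Z *)
Definition circle_plus : set circle :=
  @quotient_proj _ integers @` `[- 4^-1, 4^-1]%classic.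

End Circle.
Arguments circle_plus : clear implicits.

Section GroupUniformity.
Variable G : topologicalZmodType.

(* G seen as a uniform space through its natural group uniformity *)
Definition uniform_group : Type := G.

HB.instance Definition _ := TopologicalZmodule.copy uniform_group G.

Definition group_entourage : set_system (uniform_group * uniform_group) :=
  filter_from (nbhs (0 : G))
    (fun U : set G =>
       [set xy : uniform_group * uniform_group | U (xy.1 - xy.2)]).

Fact group_nbhs0N (U : set G) :
  nbhs (0 : G) U -> nbhs (0 : G) [set x | U (- x)].
Proof. by move=> U0; apply: opp_continuous; rewrite /= oppr0. Qed.

Fact group_entourage_filter : Filter group_entourage.
Proof.
apply: filter_from_filter; first by exists setT; exact: filterT.
by move=> U V U0 V0; exists (U `&` V) => //; exact: filterI.
Qed.

Fact group_entourage_diagonal A : group_entourage A -> diagonal `<=` A.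
Proof.
move=> [U U0 UA] [x y] xy; apply: UA => /=.
by have -> : x = y; [exact: xy|rewrite subrr; exact: nbhs_singleton].
Qed.

Fact group_entourage_inv A : group_entourage A -> group_entourage A^-1%relation.
Proof.
move=> [U U0 UA]; exists [set x | U (- x)]; first exact: group_nbhs0N.
by move=> [x y] /=; rewrite opprB => Uyx; apply: UA.
Qed.

Fact group_entourage_split A : group_entourage A ->
  exists2 B, group_entourage B & (B \; B `<=` A)%relation.
Proof.
move=> [U U0 UA].
have : nbhs ((0 : G) + 0) U by rewrite addr0.
move=> /(@add_continuous G (0, 0)) [[/= P Q] [/= P0 Q0]] PQ.
exists [set xy | (P `&` Q) (xy.1 - xy.2)].
  by exists (P `&` Q) => //; exact: filterI.
move=> [x z] /= [y [/= Pxy _] [/= _ Qyz]]; apply: UA => /=.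
rewrite -(subrKA y); exact: (PQ (x - y, y - z)).
Qed.

Fact group_nbhsE : nbhs = nbhs_ group_entourage.
Proof.
apply/funext => x; apply/seteqP; split => U /=; rewrite nbhs_E.
  move=> xU; exists [set xy : G * G | U (x - (xy.1 - xy.2))].
    exists [set z | U (x - z)] => //.
    have : nbhs (x - 0) U by rewrite subr0.
    move=> /(@sub_continuous G (x, 0)) [[/= P Q] [/= Px Q0]] PQ.
    apply: filterS Q0 => z Qz; apply: (PQ (x, z)); split => //=.
    exact: nbhs_singleton.
  by move=> y /xsectionP /=; rewrite subKr.
move=> [E [V V0 VE] EU].
have : nbhs (x - x) V by rewrite subrr.
move=> /(@sub_continuous G (x, x)) [[/= P Q] [/= Px Qx]] PQ.
apply: filterS Qx => y Qy; apply: EU; apply/xsectionP; apply: VE => /=.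
by apply: (PQ (x, y)); split => //=; exact: nbhs_singleton.
Qed.

HB.instance Definition _ := Nbhs_isUniform_mixin.Build uniform_group
  group_entourage_filter group_entourage_diagonal group_entourage_inv
  group_entourage_split group_nbhsE.

Definition complete_group : Prop :=
  forall F : set_system uniform_group,
    ProperFilter F -> cauchy F -> exists x : uniform_group, F --> x.

End GroupUniformity.

Section QuasiConvexity.
Variables (R : realType) (G : topologicalZmodType).

Definition quasi_convex (A : set G) : Prop :=
  forall x, ~ A x -> exists chi : {additive G -> circle R},
    [/\ continuous chi, chi @` A `<=` circle_plus R & ~ circle_plus R (chi x)].

Definition locally_quasi_convex : Prop :=
  forall U : set G, nbhs 0 U -> exists V : set G,
    [/\ nbhs 0 V, quasi_convex V & V `<=` U].

End QuasiConvexity.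

Record topology_on (T : Type) := TopologyOn {
  opens : set_system T ;
  opensT : opens setT ;
  opensI : forall U V, opens U -> opens V -> opens (U `&` V) ;
  opens_bigcup : forall F : set_system T,
    F `<=` opens -> opens (\bigcup_(U in F) U)
}.

(* G with its own topology forgotten and replaced by s *)
Definition retopologize (G : zmodType) (s : topology_on G) : Type := G.

Section Retopologize.
Variables (G : zmodType) (s : topology_on G).

HB.instance Definition _ := GRing.Zmodule.on (retopologize s).

Fact opens_bigU (I : Type) (f : I -> set G) :
  (forall i, opens s (f i)) -> opens s (\bigcup_i f i).
Proof.
move=> sf; rewrite -(bigcup_image setT f id).
by apply: opens_bigcup => _ [i _ <-].
Qed.

HB.instance Definition _ := isOpenTopological.Build (retopologize s)
  (opensT s) (@opensI _ s) opens_bigU.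

Definition is_group_topology : Prop :=
  continuous (fun x : retopologize s * retopologize s => x.1 - x.2).

Definition hausdorff_group_topology : Prop :=
  is_group_topology /\ hausdorff_space (retopologize s).

End Retopologize.

Section Minimality.
Variable G : topologicalZmodType.

Definition minimal : Prop :=
  hausdorff_space G /\
  ~ exists s : topology_on G,
      hausdorff_group_topology s /\ (opens s `<` @open G).

Definition locally_minimal : Prop :=
  hausdorff_space G /\
  exists2 V : set G, nbhs 0 V &
    forall s : topology_on G, opens s `<=` @open G ->
      hausdorff_group_topology s ->
      nbhs (0 : retopologize s) V -> opens s = @open G.

End Minimality.

(* (1/n)U *)
Definition nfrac (G : zmodType) (n : nat) (U : set G) : set G :=
  [set x | forall k, (1 <= k <= n)%N -> U (x *+ k)].

Definition UFSS (G : topologicalZmodType) : Prop :=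
  hausdorff_space G /\
  exists U : set G,
    [/\ nbhs 0 U, (forall x, U x -> U (- x)),
        (forall n, (1 <= n)%N -> nbhs 0 (nfrac n U)) &
        forall W : set G, nbhs 0 W ->
          exists2 n, (1 <= n)%N & nfrac n U `<=` W].

(* Normality of M is automatic here, the groups being abelian. *)
Definition almost_minimal (G : topologicalZmodType) : Prop :=
  exists M : zmodClosed G,
    [/\ closed [set` M], minimal (subgroup_type M) & UFSS (quotient_group M)].

Definition topological_group_embedding (G A : topologicalZmodType)
    (f : {additive G -> A}) : Prop :=
  injective f /\ @open G = [set f @^-1` V | V in @open A].

(* Main.v *)
From HB Require Import structures.
Require Import Defs.
From mathcomp Require Import all_boot all_order all_algebra.
From mathcomp Require Import all_classical all_reals all_analysis.
From mathcomp Require Import lra zify.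

(* Let U be a quasi-convex neighbourhood of 0 witnessing local minimality, let
   I be the set of continuous characters of G and P the subset of those mapping
   U into T_+.  The group A is T^I with the topology of uniform convergence on
   P together with pointwise convergence on I, B is the subgroup of functions
   vanishing on P, and G is mapped to A by evaluation.  The topology that A
   induces on G is Hausdorff, coarser than that of G, and has U as a
   neighbourhood of 0, hence it is the topology of G.  B is the image of the
   compact group T^I, and A/B is T^P with uniform convergence, which is UFSS
   with respect to T_+^P.  Finally N = G /\ B is closed and N + U = U: if s is
   a coarser Hausdorff group topology on N, the sets V + W, with V an
   s-neighbourhood and W a neighbourhood of 0, define a coarser Hausdorff group
   topology on G with U as a neighbourhood, so s is the topology of N. *)

Set Implicit Arguments.
Unset Strict Implicit.
Unset Printing Implicit Defensive.

Import Order.TTheory GRing.Theory Num.Theory.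
Import numFieldTopology.Exports numFieldNormedType.Exports.

Local Open Scope classical_set_scope.
Local Open Scope ring_scope.

(** * Neighbourhoods of 0 in a topological abelian group *)

Section TopologicalGroup.
Variable G : topologicalZmodType.

Lemma nbhs0_sub (U : set G) : nbhs 0 U ->
  exists2 V : set G, nbhs 0 V & forall x y, V x -> V y -> U (x - y).
Proof.
move=> U0; have : nbhs ((0 : G) - 0) U by rewrite subr0.
move=> /(@sub_continuous G (0, 0)) [[/= P Q] [/= P0 Q0]] PQ.
exists (P `&` Q); first exact: filterI.
by move=> x y [Px _] [_ Qy]; exact: (PQ (x, y)).
Qed.

Lemma translate_continuous (a : G) : continuous (fun x => a + x).
Proof.
move=> x; apply: (@continuous_comp _ (G * G)%type _ (fun x : G => (a, x))
  (fun x : G * G => x.1 + x.2)); last exact: add_continuous.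
by apply: cvg_pair; [exact: cvg_cst|exact: cvg_id].
Qed.

Lemma nbhs_translate (x : G) (U : set G) :
  nbhs x U <-> nbhs 0 [set y | U (x + y)].
Proof.
split=> [xU|]; first by apply: translate_continuous; rewrite addr0.
rewrite -{1}(addNr x) => /(translate_continuous (a := - x)); rewrite /nbhs /=.
by apply: filterS => y /=; rewrite addNKr.
Qed.

Lemma openP0 (U : set G) :
  open U <-> forall x, U x -> nbhs 0 [set y | U (x + y)].
Proof.
rewrite openE; split=> oU x Ux; first exact/(nbhs_translate x U).1/oU.
exact/(nbhs_translate x U).2/oU.
Qed.

(** The second hypothesis says that x lies in C + U for every neighbourhood U of 0. *)
Lemma closed_translate (C : set G) (x : G) : closed C ->
  (forall U : set G, nbhs 0 U -> exists2 y, U y & C (x - y)) -> C x.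
Proof.
move=> clC Cx; apply: clC => U; rewrite -{1}(subr0 x).
move=> /(@sub_continuous G (x, 0)) [[/= P Q] [/= Px Q0]] PQ.
have [y Qy Cxy] := Cx _ Q0; exists (x - y); split=> //.
by apply: (PQ (x, y)); split=> //; exact: nbhs_singleton.
Qed.

Lemma hausdorff_separated :
  (forall x : G, (forall U : set G, nbhs 0 U -> U x) -> x = 0) ->
  hausdorff_space G.
Proof.
move=> sepG p q pq; apply/eqP; rewrite -subr_eq0; apply/eqP/sepG => U U0.
have [V V0 VU] := nbhs0_sub U0.
(* A point z common to p + V and q + V gives p - q = (z - q) - (z - p), an element of V - V. *)
have /(_ _)[] := pq [set z | V (z - p)] [set z | V (z - q)].
- apply/nbhs_translate; apply: filterS V0 => y.
  by rewrite /= addrAC subrr add0r.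
- apply/nbhs_translate; apply: filterS V0 => y.
  by rewrite /= addrAC subrr add0r.
move=> z /= [Vp Vq]; have := VU _ _ Vq Vp.
by rewrite opprB addrC subrKA.
Qed.

Lemma separated_hausdorff (x : G) :
  hausdorff_space G -> (forall U : set G, nbhs 0 U -> U x) -> x = 0.
Proof.
move=> hG xU; apply: hG => A B xA B0; exists x; split.
  exact: nbhs_singleton.
exact: xU.
Qed.

End TopologicalGroup.

Lemma additive_continuous (G H : topologicalZmodType) (h : {additive G -> H}) :
  (forall U : set H, nbhs 0 U -> nbhs 0 (h @^-1` U)) -> continuous h.
Proof.
move=> h0 x U /nbhs_translate /h0 hU; apply/nbhs_translate.
by apply: filterS hU => y; rewrite /= raddfD.
Qed.

(** * Group topologies generated by a filter of neighbourhoods of 0 *)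

Record zero_filter (G : zmodType) := ZeroFilter {
  zero_filter_sets :> set G -> Prop ;
  zero_filterF : Filter zero_filter_sets ;
  zero_filter0 : forall U, zero_filter_sets U -> U 0 ;
  zero_filterB : forall U, zero_filter_sets U ->
    exists2 V, zero_filter_sets V & forall x y, V x -> V y -> U (x - y)
}.
#[global] Existing Instance zero_filterF.

Section ZeroFilterTopology.
Variables (G : zmodType) (F : zero_filter G).

Definition zero_filter_open (U : set G) :=
  forall x, U x -> F [set y | U (x + y)].

Fact zero_filter_openT : zero_filter_open setT.
Proof. by move=> x _; exact: filterT. Qed.

Fact zero_filter_openI U V :
  zero_filter_open U -> zero_filter_open V -> zero_filter_open (U `&` V).
Proof. by move=> oU oV x [Ux Vx]; apply: filterI; [exact: oU|exact: oV]. Qed.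

Fact zero_filter_open_bigcup (H : set_system G) :
  H `<=` zero_filter_open -> zero_filter_open (\bigcup_(U in H) U).
Proof.
by move=> oH x [U HU Ux]; apply: filterS (oH _ HU _ Ux) => y Uy; exists U.
Qed.

Definition zero_filter_topology : topology_on G :=
  TopologyOn zero_filter_openT zero_filter_openI zero_filter_open_bigcup.

Definition zero_filter_group : Type := retopologize zero_filter_topology.

HB.instance Definition _ := Topological.copy zero_filter_group
  (retopologize zero_filter_topology).
HB.instance Definition _ := GRing.Zmodule.on zero_filter_group.

Lemma zero_filterD U : F U ->
  exists2 V, F V & forall x y, V x -> V y -> U (x + y).
Proof.
move=> /zero_filterB[V FV VU]; have [W FW WV] := zero_filterB FV.
exists (V `&` W); first exact: filterI.
move=> x y [Vx _] [_ Wy]; rewrite -(opprK y); apply: VU => //.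
by rewrite -sub0r; apply: WV => //; exact: zero_filter0 FW.
Qed.

Lemma nbhs_zero_filter (x : zero_filter_group) (U : set zero_filter_group) :
  nbhs x U <-> F [set y | U (x + y)].
Proof.
split=> [[W [oW Wx WU]]|FU].
  by apply: filterS (oW _ Wx) => y; exact: WU.
(* This is the interior of U: it is open because a member of F contains V + V for another member
   V. *)
exists [set z | F [set y | U (z + y)]]; split => //=.
- move=> z /= /zero_filterD [V FV VU]; apply: filterS (FV) => v Vv /=.
  by apply: filterS (FV) => w Vw /=; rewrite -addrA; exact: VU.
- by move=> z /zero_filter0 /=; rewrite addr0.
Qed.

Lemma zero_filter_nbhs0 : nbhs (0 : zero_filter_group) = F.
Proof.
apply/seteqP; split => U.
  move/nbhs_zero_filter.
  by apply: (@filterS G F) => y /=; rewrite add0r.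
move=> FU; apply/nbhs_zero_filter.
by apply: (@filterS G F) FU => y /=; rewrite add0r.
Qed.

Fact zero_filter_sub_continuous :
  continuous (fun x : zero_filter_group * zero_filter_group => x.1 - x.2).
Proof.
move=> [x y] U /nbhs_zero_filter /= /zero_filterB [V FV VU].
exists ([set z | V (z - x)], [set z | V (z - y)]) => /=.
  by split; apply/nbhs_zero_filter; apply: filterS FV => z;
    rewrite /= addrAC subrr add0r.
move=> [z w] /= [Vz Vw]; have := VU _ _ Vz Vw => /=.
by rewrite opprB addrACA (addrC x) subrK addKr.
Qed.

HB.instance Definition _ :=
  PreTopologicalNmodule_isTopologicalZmodule.Build zero_filter_group
    zero_filter_sub_continuous.

Lemma zero_filter_group_topology : is_group_topology zero_filter_topology.
Proof. exact: zero_filter_sub_continuous. Qed.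

End ZeroFilterTopology.

(** * Minimality of compact groups, and the topology of subgroups *)

Lemma compact_minimal (G : topologicalZmodType) :
  hausdorff_space G -> compact [set: G] -> minimal G.
Proof.
move=> hG cG; split=> // -[s [[_ hs] [sG]]]; apply => U oU.
(* The identity onto a coarser Hausdorff topology is a closed map: closed sets are compact, so their
   images are compact and hence closed. *)
have cid : continuous (id : G -> retopologize s).
  by apply/continuousP => V; exact: sG.
have : compact (id @` (~` U) : set (retopologize s)).
  apply: continuous_compact; first exact: continuous_subspaceT.
  by apply: (subclosed_compact _ cG) => //; exact: open_closedC.
move=> /(compact_closed hs); rewrite image_id => /closed_openC.
by rewrite setCK.
Qed.

Section SubgroupTopology.
Variables (G : topologicalZmodType) (B : zmodClosed G).

Lemma subgroup_nbhs0 (U : set (subgroup_type B)) : nbhs 0 U <->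
  exists2 W : set G, nbhs 0 W & forall x : subgroup_type B, W (val x) -> U x.
Proof.
split=> [[_ [[W oW <-] /= W0 WU]]|[W W0 WU]].
  exists W; last exact: WU.
  by apply: open_nbhs_nbhs; split.
apply: filterS WU _; apply: (@subgroup_val_continuous G B 0).
by rewrite raddf0.
Qed.

Lemma subgroup_hausdorff :
  hausdorff_space G -> hausdorff_space (subgroup_type B).
Proof.
move=> hG; apply: hausdorff_separated => x xU; apply: val_inj.
rewrite raddf0; apply: (separated_hausdorff hG) => U U0.
by apply: (xU (val @^-1` U)); apply/subgroup_nbhs0; exists U.
Qed.

Lemma subgroup_compact :
  compact [set` B] -> compact [set: subgroup_type B].
Proof.
move=> cB F FF _; have [|x [Bx clx]] := cB (val @ F) (fmap_proper_filter _ FF).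
  by apply: (@filterE _ F) => x; exact: (valP x).
exists (exist _ x Bx); split=> // U W FU [_ [[Q' oO <-] /= Ox OW]].
have [||y [/= [u Uu <-] Ou]] := clx (val @` U) Q'.
- by apply: (@filterS _ F) FU => y Uy; exists y.
- exact: open_nbhs_nbhs.
by exists u; split=> //; exact: OW.
Qed.

End SubgroupTopology.

(** * Extending a coarser topology from a subgroup to the whole group *)

Section SumFilter.
Variables (T G : topologicalZmodType) (h : T -> G).
Hypothesis hB : {morph h : x y / x - y}.

(** T stands for a subgroup with a coarser topology and h for its inclusion. Only additivity of h is
    assumed, as the inclusion need not be continuous for that topology. *)
Definition sum_filter (U : set G) : Prop :=
  exists W : set T * set G, [/\ nbhs 0 W.1, nbhs 0 W.2 &
    forall x y, W.1 x -> W.2 y -> U (h x + y)].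

Fact sum_filterF : Filter sum_filter.
Proof.
split.
- by exists (setT, setT); split=> //; exact: filterT.
- move=> U U' [[W1 W2] /= [W10 W20 WU]] [[W1' W2'] /= [W10' W20' WU']].
  exists (W1 `&` W1', W2 `&` W2'); split=> /=.
  + exact: filterI.
  + exact: filterI.
  + by move=> x y [? ?] [? ?]; split; [exact: WU|exact: WU'].
- move=> U U' UU' [W [W10 W20 WU]]; exists W; split=> // x y W1x W2y.
  exact/UU'/WU.
Qed.

Fact sum_filter0 U : sum_filter U -> U 0.
Proof.
move=> [[W1 W2] /= [W10 W20 WU]].
have := WU _ _ (nbhs_singleton W10) (nbhs_singleton W20).
by rewrite addr0 -{1}(subrr 0) hB subrr.
Qed.

Fact sum_filterB U : sum_filter U ->
  exists2 W, sum_filter W & forall x y, W x -> W y -> U (x - y).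
Proof.
move=> [[W1 W2] /= [/nbhs0_sub[A A0 AW] /nbhs0_sub[B B0 BW] WU]].
exists [set z | exists x y, [/\ A x, B y & z = h x + y]].
  by exists (A, B); split=> //= x y Ax By; exists x, y.
move=> _ _ [x [y [Ax By ->]]] [x' [y' [Ax' By' ->]]].
rewrite opprD addrACA -hB; apply: WU; first exact: AW.
exact: BW.
Qed.

Definition sum_zero_filter := ZeroFilter sum_filterF sum_filter0 sum_filterB.

End SumFilter.

(** * Minimality of a closed subgroup whose translations preserve V *)

Section LocallyMinimalSubgroup.
Variables (G : topologicalZmodType) (N : zmodClosed G) (V : set G).
Hypotheses (hG : hausdorff_space G) (V0 : nbhs 0 V).
Hypothesis minV : forall s : topology_on G, opens s `<=` @open G ->
  hausdorff_group_topology s -> nbhs (0 : retopologize s) V ->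
  opens s = @open G.
Hypotheses (clN : closed [set` N]).
Hypothesis NV : forall x y, x \in N -> V y -> V (x + y).

Lemma minimal_subgroup : minimal (subgroup_type N).
Proof.
split; first exact: subgroup_hausdorff.
move=> [s [[gs hs] [sN]]]; apply => _ [U oU <-].
pose T : topologicalZmodType := HB.pack_for topologicalZmodType (retopologize s)
  (PreTopologicalNmodule_isTopologicalZmodule.Build (retopologize s) gs).
have nbhsT (W : set (subgroup_type N)) : nbhs (0 : T) W ->
    nbhs (0 : subgroup_type N) W.
  move=> [Q' [oO O0 OW]]; apply: (filterS OW).
  by apply: open_nbhs_nbhs; split=> //; exact: sN.
pose F := @sum_zero_filter T G (val : subgroup_type N -> G) (raddfB _).
have oF : opens (zero_filter_topology F) = @open G.
  apply: minV.
  - move=> O' oO; apply/openP0 => x /oO [[W1 W2] /= [W10 W20 WO]].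
    apply: filterS W20 => y W2y /=; rewrite -[y]add0r.
    rewrite -[X in X + y](raddf0 (val : subgroup_type N -> G)).
    by apply: WO => //; exact: (@nbhs_singleton T 0 _ W10).
  - split; first exact: zero_filter_group_topology.
    apply: (@hausdorff_separated (zero_filter_group F)) => x xU.
    have xW (W1 : set T) (W2 : set G) : nbhs (0 : T) W1 -> nbhs 0 W2 ->
        exists (v : subgroup_type N) w, [/\ W1 v, W2 w & x = val v + w].
      move=> W10 W20.
      apply: (xU [set z | exists v w, [/\ _, _ & z = val v + w]]).
      rewrite zero_filter_nbhs0; exists (W1, W2); split=> //= v w W1v W2w.
      by exists v, w.
    (* A point in all neighbourhoods of 0 for the sum topology lies in N + Q for every neighbourhood
       Q of 0 in G, hence in the closure of N. *)
    have Nx : x \in N.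
      apply: (closed_translate clN) => Q Q0.
      have [v [w [_ Qw xE]]] := xW setT Q filterT Q0.
      by exists w; rewrite // xE addrK; exact: (valP v).
    (* It remains to use that s is Hausdorff. Write x = v + w with v in W and -w in Q. As x and v
       are in N, so is v - x = -w, which therefore lies in W, and x = v - (v - x) lies in W - W,
       inside U'. *)
    suff : exist _ x Nx = 0 :> T by move=> /(congr1 val).
    apply: (@separated_hausdorff T) => // U' U'0.
    have [W W0 WU] := @nbhs0_sub T U' U'0.
    have /nbhsT/subgroup_nbhs0[Q /group_nbhs0N Q0 QW] := W0.
    have [v [w [Wv Qw xE]]] := xW W _ W0 Q0.
    rewrite -(subKr (v : T) (exist _ x Nx : T)); apply: WU => //.
    by apply: QW; rewrite raddfB /= xE opprD addNKr.
  - apply/(@nbhs_zero_filter G F); exists (setT, V); split=> //=.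
      exact: (@filterT _ (nbhs (0 : T))).
    by move=> x y _ Vy; rewrite add0r; apply: NV => //; exact: (valP x).
(* U is now open for the sum topology, so around each of its points x in N it contains x + W1 + 0
   with W1 an s-neighbourhood of 0. *)
suff : @open T (val @^-1` U) by [].
apply/openP0 => x Ux; move: oU; rewrite -oF => /(_ _ Ux).
move=> [[W1 W2] /= [W10 W20 WU]].
apply: filterS W10 => v W1v; have /= := WU _ _ W1v (nbhs_singleton W20).
by rewrite addr0.
Qed.

End LocallyMinimalSubgroup.

(** * The sets (1/n)U in a topological group *)

Section MultiplesInGroup.
Variable G : topologicalZmodType.

Lemma mulrn_continuous (n : nat) : continuous (fun x : G => x *+ n).
Proof.
elim: n => [|n ihn] x; first exact: cvg_cst.
rewrite (_ : (fun x : G => _) = (fun x : G => x + x *+ n)); last first.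
  by apply/funext => y; rewrite mulrS.
apply: (@continuous_comp _ (G * G)%type _ (fun x : G => (x, x *+ n))
  (fun x : G * G => x.1 + x.2)); last exact: add_continuous.
by apply: cvg_pair; [exact: cvg_id|exact: ihn].
Qed.

Lemma nfrac_nbhs0 (n : nat) (U : set G) : nbhs 0 U -> nbhs 0 (nfrac n U).
Proof.
move=> U0; elim: n => [|n ihn].
  by apply: filterE => x k /andP[k1 k0]; move: (leq_trans k1 k0).
have : nbhs 0 [set x : G | U (x *+ n.+1)].
  by apply: mulrn_continuous; rewrite /= mul0rn.
move=> /(filterI ihn); apply: filterS => x [nx Ux] k /andP[k1].
rewrite leq_eqVlt => /predU1P[->//|kn]; apply: nx.
by rewrite k1.
Qed.

Lemma nfrac_closed (n : nat) (U : set G) : closed U -> closed (nfrac n U).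
Proof.
move=> cU; rewrite (_ : nfrac n U =
  \bigcap_(k in [set k | (1 <= k <= n)%N]) (fun x => x *+ k) @^-1` U) //.
apply: closed_bigI => k _.
by have /continuous_closedP/(_ _ cU) := @mulrn_continuous k.
Qed.

End MultiplesInGroup.

(** * Quotient groups *)

Section Quotient.
Variables (G : topologicalZmodType) (B : zmodClosed G).

HB.instance Definition _ := GRing.isZmodMorphism.Build G (quotient_group B)
  (@quotient_proj G B) (@quotient_projB G B).

Lemma quotient_proj_continuous : continuous (@quotient_proj G B).
Proof. exact: pi_continuous. Qed.

Lemma quotient_proj_nbhs0 (U : set G) :
  nbhs 0 U -> nbhs 0 (@quotient_proj G B @` U).
Proof.
rewrite nbhsE => -[W [oW W0] WU].
apply: (@filterS _ _ _ (@quotient_proj G B @` W)); first exact: image_subset.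
apply: open_nbhs_nbhs; split; first exact: quotient_proj_open.
by exists 0; rewrite // raddf0.
Qed.

Lemma quotient_hausdorff :
  closed [set` B] -> hausdorff_space (quotient_group B).
Proof.
move=> clB; apply: hausdorff_separated => z; have [x <-] := quotient_projP z.
move=> xU; rewrite -(raddf0 (@quotient_proj G B)); apply: quotient_proj_eq0.
rewrite subr0; apply: (closed_translate clB) => U U0.
have [y Uy /esym/quotient_proj_eq xy] := xU _ (quotient_proj_nbhs0 U0).
by exists y.
Qed.

End Quotient.

(** * The circle group and the sets (1/n)T_+ *)

Section CircleTheory.
Variable R : realType.
Local Notation proj := (@quotient_proj R^o (integers R)).

Lemma integers_closed : closed [set` integers R].
Proof.
move=> s cls; suff : s \is a Num.int by [].
rewrite intrEfloor; apply/eqP/esym/eqP; rewrite eq_le floor_le andbT leNgt.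
apply/negP => fs; pose f : R := (Num.floor s)%:~R.
have sf1 : s < f + 1 by rewrite -intrD1 floorD1_gt.
(* A ball of this radius around s stays strictly between the consecutive integers f and f + 1. *)
have d0 : 0 < Num.min (s - f) (f + 1 - s) by rewrite lt_min !subr_gt0 fs sf1.
have [m [/= mint]] := cls _ (nbhsx_ballx s _ d0).
rewrite -ball_normE /= => sm.
have /intrP[k mE] : m \is a Num.int by [].
move: sm; rewrite mE lt_min !ltr_norml => /andP[/andP[_ fk] /andP[kf _]].
have : (Num.floor s < k)%Z by rewrite -(ltr_int R); move: fk; rewrite /f; lra.
have : (k < Num.floor s + 1)%Z.
  by rewrite -(ltr_int R) intrD; move: kf; rewrite /f; lra.
by rewrite ltzD1 => /le_lt_trans/[apply]; rewrite ltxx.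
Qed.

Lemma circle_hausdorff : hausdorff_space (circle R).
Proof. exact: quotient_hausdorff integers_closed. Qed.

Lemma circle_proj_compact (a b : R) : compact (proj @` `[a, b]).
Proof.
apply: continuous_compact; last exact: segment_compact.
by apply: continuous_subspaceT; exact: quotient_proj_continuous.
Qed.

Lemma circle_compact : compact [set: circle R].
Proof.
suff -> : [set: circle R] = proj @` `[0, 1] by exact: circle_proj_compact.
apply/seteqP; split=> // z _; have [x <-] := quotient_projP z.
exists (x - (Num.floor x)%:~R) => /=.
  rewrite in_itv /= subr_ge0 floor_le /= lerBlDr addrC ltW //.
  by have := floorD1_gt x; rewrite intrD.
apply: quotient_proj_eq0; rewrite addrAC subrr sub0r rpredN.
exact: intr_int.
Qed.

Lemma circle_plus_closed : closed (circle_plus R).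
Proof.
apply: (compact_closed circle_hausdorff); exact: circle_proj_compact.
Qed.

Lemma circle_plusN t : circle_plus R t -> circle_plus R (- t).
Proof.
move=> [x /=]; rewrite in_itv /= => /andP[x1 x2] <-; exists (- x).
  by rewrite /= in_itv /= lerN2 x2 lerNl x1.
exact: raddfN.
Qed.

Lemma circle_plus_nbhs0 : nbhs 0 (circle_plus R).
Proof.
apply: quotient_proj_nbhs0; apply/(@nbhs_norm0P R R^o); exists 4^-1 => //= x /=.
by rewrite in_itv /= => /ltW; rewrite ler_norml.
Qed.

Lemma circle_frac_nbhs0 n : nbhs 0 (nfrac n (circle_plus R)).
Proof. exact: nfrac_nbhs0 circle_plus_nbhs0. Qed.

Lemma circle_frac0 n : nfrac n (circle_plus R) 0.
Proof. exact: nbhs_singleton (circle_frac_nbhs0 n). Qed.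

(** The multiples of t cannot wind around the circle: if |kx| is at most 1/4, then (k+1)x has
    absolute value at most 1/2, and a real number in that range whose class is in T_+ is itself in
    [-1/4, 1/4]. *)
Lemma circle_fracP (n : nat) (t : circle R) : nfrac n.+1 (circle_plus R) t ->
  exists2 x : R, t = proj x & `|x *+ n.+1| <= 4^-1.
Proof.
move=> nt; have [x /=] := nt 1 isT; rewrite in_itv /= -ler_norml => x4 xt.
exists x; first by rewrite xt.
suff : forall k, (k <= n.+1)%N -> `|x *+ k| <= 4^-1 by exact.
elim=> [_|k ihk kn]; first by rewrite mulr0n normr0.
have [r /=] := nt k.+1 kn; rewrite in_itv /= -ler_norml => r4.
rewrite mulr1n in xt; rewrite -xt -raddfMn => /esym/quotient_proj_eq.
move=> /intrP[m mE]; have /(_ (ltnW kn)) xk := ihk.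
(* The integer m = x + kx - r is bounded by 3/4, each of the three terms being at most 1/4. *)
have : `|(m%:~R : R)| < 1.
  rewrite -mE mulrS; have := ler_normD x (x *+ k).
  have := ler_normB (x + x *+ k) r; lra.
rewrite -intr_norm -[1]/(1%:~R) ltr_int => m1.
have m0 : m = 0 by lia.
by move: mE; rewrite m0 => /eqP; rewrite subr_eq0 => /eqP ->.
Qed.

Lemma circle_frac_basis (W : set (circle R)) : nbhs 0 W ->
  exists2 n, (1 <= n)%N & nfrac n (circle_plus R) `<=` W.
Proof.
rewrite -(raddf0 proj).
move=> /quotient_proj_continuous/(@nbhs_norm0P R R^o)[e /= e0 eW].
(* This integer exceeds 1/e, so the representative x of t satisfies |x| < e/4. *)
exists (Num.truncn e^-1).+1 => // t /circle_fracP[x -> x4].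
apply: eW => /=; rewrite normrMn in x4.
have : e^-1 < (Num.truncn e^-1).+1%:R by exact: truncnS_gt.
rewrite -(ltr_pM2r e0) mulVf ?gt_eqF // => n1.
have n0 : 0 < (Num.truncn e^-1).+1%:R :> R by rewrite ltr0n.
rewrite -(ltr_pM2l n0); move: x4; rewrite -mulr_natl; lra.
Qed.

Lemma circle_frac_eq0 (t : circle R) :
  (forall n, nfrac n (circle_plus R) t) -> t = 0.
Proof.
move=> nt; apply: (separated_hausdorff circle_hausdorff) => U.
by move=> /circle_frac_basis[n _]; apply.
Qed.

End CircleTheory.

Lemma filter_seqI (I : eqType) (T : Type) (F : set_system T) (E : seq I)
    (W : I -> set T) : Filter F ->
  (forall i, i \in E -> F (W i)) -> F [set x | forall i, i \in E -> W i x].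
Proof.
move=> FF; elim: E => [_|j E ihE FW]; first exact: filterE.
have FE : F [set x | forall i, i \in E -> W i x].
  by apply: ihE => i iE; apply: FW; rewrite inE iE orbT.
have Fj : F (W j) by apply: FW; exact: mem_head.
apply: filterS (filterI Fj FE) => x [Wj WE] i; rewrite inE.
by move=> /predU1P[->//|]; exact: WE.
Qed.

(** * The group T^I, uniform on P and pointwise on I *)

Section UniformPower.
Variables (R : realType) (I : choiceType) (P : set I).
Local Notation Tplus := (circle_plus R).

(** By [circle_frac_basis] the sets (1/n)T_+ can replace arbitrary neighbourhoods of 0 in T, so a
    single number n expresses uniformity over S. For n = 0 there is no condition. *)
Definition box (n : nat) (S : set I) : set (I -> circle R) :=
  [set f | forall i, S i -> nfrac n Tplus (f i)].

(* Generated by the neighbourhoods of 0 for uniform convergence on P and for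
   pointwise convergence on I. *)
Definition power_filter (U : set (I -> circle R)) : Prop :=
  exists n (E : seq I), box n (P `|` [set` E]) `<=` U.

Lemma box_sub (m n : nat) (S S' : set I) :
  (m <= n)%N -> S `<=` S' -> box n S' `<=` box m S.
Proof.
move=> mn SS f bf i /SS S'i k /andP[k1 km]; apply: bf => //.
by rewrite k1 (leq_trans km).
Qed.

Fact power_filterF : Filter power_filter.
Proof.
split.
- by exists 0, [::].
- move=> U U' [n [E EU]] [n' [E' EU']]; exists (maxn n n'), (E ++ E') => f bf.
  split; [apply: EU|apply: EU'].
  + apply: box_sub bf; first exact: leq_maxl.
    by apply: setUS => i /= iE; rewrite mem_cat iE.
  + apply: box_sub bf; first exact: leq_maxr.
    by apply: setUS => i /= iE; rewrite mem_cat iE orbT.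
- by move=> U U' UU' [n [E EU]]; exists n, E; apply: subset_trans UU'.
Qed.

Fact power_filter0 U : power_filter U -> U 0.
Proof. by move=> [n [E]]; apply => i _; exact: circle_frac0. Qed.

Fact power_filterB U : power_filter U ->
  exists2 V, power_filter V & forall x y, V x -> V y -> U (x - y).
Proof.
move=> [n [E EU]]; have [V V0 VB] := nbhs0_sub (circle_frac_nbhs0 R n).
have [m _ mV] := circle_frac_basis V0.
exists (box m (P `|` [set` E])); first by exists m, E.
by move=> x y bx by_; apply: EU => i Si; apply: VB; apply: mV;
  [exact: bx|exact: by_].
Qed.

Definition upower : topologicalZmodType :=
  zero_filter_group (ZeroFilter power_filterF power_filter0 power_filterB).

Lemma upower_nbhs0 (U : set upower) : nbhs 0 U <->
  exists n (E : seq I), box n (P `|` [set` E]) `<=` U.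
Proof. by rewrite zero_filter_nbhs0. Qed.

Lemma box_nbhs0 n (E : seq I) : nbhs (0 : upower) (box n (P `|` [set` E])).
Proof. by apply/upower_nbhs0; exists n, E. Qed.

Lemma upower_hausdorff : hausdorff_space upower.
Proof.
apply: hausdorff_separated => x xU; apply/funext => i.
apply: circle_frac_eq0 => n; apply: (xU _ (box_nbhs0 n [:: i])).
by right; rewrite /= mem_head.
Qed.

Section Evaluation.
Variables (i : I) (k : nat).

Definition eval_mul (x : upower) : circle R := x i *+ k.

Fact eval_mulB : {morph eval_mul : x y / x - y}.
Proof. by move=> x y; rewrite /eval_mul -mulrnBl. Qed.

HB.instance Definition _ :=
  GRing.isZmodMorphism.Build upower (circle R) eval_mul eval_mulB.

Lemma eval_mul_continuous : continuous eval_mul.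
Proof.
apply: additive_continuous => U U0.
have : nbhs 0 [set t : circle R | U (t *+ k)].
  by apply: (@mulrn_continuous (circle R) k 0 U); rewrite mul0rn.
move=> /circle_frac_basis[n _ nU].
apply: filterS (box_nbhs0 n [:: i]) => x bx; apply/nU/bx.
by right; rewrite /= mem_head.
Qed.

End Evaluation.

(** A box is an intersection of preimages of T_+ under the characters [eval_mul i k], and one whose
    condition fails at x separates x from the box. *)
Lemma box_quasi_convex n S : quasi_convex R (box n S : set upower).
Proof.
move=> x /existsNP[i /not_implyP[Si /existsNP[k /not_implyP[kn nx]]]].
exists (eval_mul i k : {additive upower -> circle R}); split=> //.
  exact: eval_mul_continuous.
by move=> _ [y yb <-]; exact: yb.
Qed.

Lemma upower_lqc : locally_quasi_convex R upower.
Proof.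
move=> U /upower_nbhs0[n [E EU]]; exists (box n (P `|` [set` E])).
by split=> //; [exact: box_nbhs0|exact: box_quasi_convex].
Qed.

Lemma ptws_compact : compact [set: {ptws I -> circle R}].
Proof.
have := tychonoff (fun _ : I => @circle_compact R).
by congr (compact _); apply/seteqP; split.
Qed.

(* A Cauchy filter converges to its cluster points for the product topology
   since the boxes are closed for that topology. *)
Lemma upower_complete : complete_group upower.
Proof.
move=> F FF cF; have [|f [_ clf]] := @ptws_compact F FF; first exact: filterT.
exists f => U /= /(nbhs_translate (f : upower) U).1 /upower_nbhs0[n [E EU]].
have : entourage [set xy : uniform_group upower * uniform_group upower |
    box n (P `|` [set` E]) (xy.1 - xy.2)].
  by exists (box n (P `|` [set` E])) => //; exact: box_nbhs0.
move=> /cF[[A1 A2] /= [FA1 FA2] AB].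
apply: filterS FA1 => y A1y; rewrite -(subrK f y) addrC.
apply: EU => i Si.
pose C := [set t : circle R | nfrac n Tplus ((y : upower) i - t)].
have clC : closed (proj i @^-1` C : set {ptws I -> circle R}).
  have /continuous_closedP : continuous (proj i : {ptws I -> circle R} -> _).
    exact: proj_continuous.
  apply; have /continuous_closedP : continuous (fun t => (y : upower) i - t).
    move=> t; apply: (@continuous_comp _ _ _ (-%R)).
      exact: opp_continuous.
    exact: translate_continuous.
  by apply; apply: nfrac_closed; exact: circle_plus_closed.
apply: clC => W Wf; have [|z [A2z Wz]] := clf A2 W _ Wf => //.
by exists z; split=> //; exact: (AB (y, z)).
Qed.

Definition vanishing_pred : pred upower :=
  [pred x : upower | `[< forall i, P i -> x i = 0 >]].

Fact vanishing_zmod_closed : zmod_closed vanishing_pred.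
Proof.
split=> [|x y]; rewrite !inE // => x0 y0 i Pi.
by rewrite -[LHS]/(x i - y i) x0 // y0 // subr0.
Qed.

HB.instance Definition _ :=
  GRing.isZmodClosed.Build upower vanishing_pred vanishing_zmod_closed.

Definition vanishing : zmodClosed upower :=
  GRing.ZmodClosed.clone upower vanishing_pred _.

Lemma vanishingP (x : upower) :
  reflect (forall i, P i -> x i = 0) (x \in vanishing).
Proof. exact: asboolP. Qed.

Definition off (g : I -> circle R) : upower :=
  fun i => if `[< P i >] then 0 else g i.

Lemma off_vanishing g : off g \in vanishing.
Proof. by apply/vanishingP => i Pi; rewrite /off asboolT. Qed.

(** The coordinates in P, the only ones with a uniform condition, become constant, so pointwise
    convergence at the finitely many indices of E suffices. *)
Lemma off_continuous : continuous (off : {ptws I -> circle R} -> upower).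
Proof.
move=> g U /nbhs_translate/upower_nbhs0[n [E EU]].
have : nbhs g [set h : {ptws I -> circle R} |
    forall i, i \in E -> nfrac n Tplus (h i - g i)].
  apply: (@filter_seqI I _ (nbhs (g : {ptws I -> circle R})) E
    (fun i h => nfrac n Tplus (h i - g i))) => i _.
  apply: (@proj_continuous I (fun=> circle R) i g
    [set t | nfrac n Tplus (t - g i)]).
  apply/nbhs_translate; apply: filterS (circle_frac_nbhs0 R n) => t.
  by rewrite /= /proj addrAC subrr add0r.
apply: filterS => h hE; rewrite /= -(subrK (off g) (off h)) addrC.
apply: EU => i Si; rewrite -[X in nfrac _ _ X]/(off h i - off g i) /off.
case: asboolP => [_|nPi]; first by rewrite subrr; exact: circle_frac0.
by case: Si => [//|/= iE]; exact: hE.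
Qed.

Lemma vanishing_compact : compact [set` vanishing].
Proof.
suff -> : [set` vanishing] = off @` [set: {ptws I -> circle R}].
  apply: continuous_compact; last exact: ptws_compact.
  by apply: continuous_subspaceT; exact: off_continuous.
apply/seteqP; split=> [x /vanishingP x0|_ [g _ <-]]; last exact: off_vanishing.
exists x => //; apply/funext => i; rewrite /off.
by case: asboolP => // /x0 ->.
Qed.

Lemma vanishing_closed : closed [set` vanishing].
Proof. exact: (compact_closed upower_hausdorff vanishing_compact). Qed.

Lemma upower_quotient_UFSS : UFSS (quotient_group vanishing).
Proof.
split; first exact: quotient_hausdorff vanishing_closed.
pose U0 : set upower := [set f | forall i, P i -> Tplus (f i)].
have U00 : nbhs 0 (quotient_proj vanishing @` U0).
  apply: quotient_proj_nbhs0; apply: filterS (box_nbhs0 1 [::]) => f bf i Pi.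
  by apply: (bf i _ 1) => //; left.
exists (quotient_proj vanishing @` U0); split=> //.
- move=> _ [x U0x <-]; exists (- x); last exact: raddfN.
  by move=> i Pi; apply: circle_plusN; exact: U0x.
- by move=> n _; exact: nfrac_nbhs0.
move=> W; rewrite -(raddf0 (quotient_proj vanishing)).
move=> /quotient_proj_continuous/upower_nbhs0[n [E EW]].
(* The successor is taken because n may be 0, whereas UFSS asks for a positive integer. *)
exists n.+1 => // z; have [x <-] := quotient_projP z => nx.
have xP : box n.+1 P x.
  (* The class of kx has a representative u in U0, and u agrees with kx on P. *)
  move=> i Pi k kn; have [u U0u] := nx k kn.
  rewrite -raddfMn => /quotient_proj_eq/vanishingP/(_ i Pi)/eqP.
  rewrite -[X in X == _]/(u i - (x *+ k) i) subr_eq0 => /eqP ux.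
  have -> : x i *+ k = (x *+ k) i by elim: (k) => [//|j ih]; rewrite !mulrS ih.
  by rewrite -ux; exact: U0u.
(* This representative is zero outside P, which disposes of the conditions at the indices of E. *)
have -> : quotient_proj vanishing x = quotient_proj vanishing (x - off x).
  by apply: quotient_proj_eq0; rewrite subKr; exact: off_vanishing.
apply: EW => i _; rewrite -[X in nfrac _ _ X]/(x i - off x i) /off.
case: asboolP => Pi; last by rewrite subrr; exact: circle_frac0.
by rewrite subr0; apply: box_sub xP i Pi.
Qed.

End UniformPower.

(** * Embeddings obtained from local minimality *)

Section InducedTopology.
Variables (G A : topologicalZmodType) (f : {additive G -> A}).

Definition preim_filter : set_system G := filter_from (nbhs 0) (preimage f).

Fact preim_filterF : Filter preim_filter.
Proof.
apply: filter_from_filter; first by exists setT; exact: filterT.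
by move=> U V U0 V0; exists (U `&` V) => //; exact: filterI.
Qed.

Fact preim_filter0 U : preim_filter U -> U 0.
Proof. by move=> [W /nbhs_singleton W0]; apply; rewrite /= raddf0. Qed.

Fact preim_filterB U : preim_filter U ->
  exists2 V, preim_filter V & forall x y, V x -> V y -> U (x - y).
Proof.
move=> [W /nbhs0_sub[V V0 VW] WU]; exists (f @^-1` V); first by exists V.
by move=> x y Vx Vy; apply: WU; rewrite /= raddfB; exact: VW.
Qed.

Let F := ZeroFilter preim_filterF preim_filter0 preim_filterB.

(** The topology induced by f is coarser by continuity and Hausdorff by injectivity, and W makes V a
    neighbourhood of 0 for it, so local minimality applies. *)
Lemma locally_minimal_embedding (V : set G) (W : set A) :
  hausdorff_space A -> injective f -> continuous f ->
  nbhs 0 W -> f @^-1` W `<=` V ->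
  (forall s : topology_on G, opens s `<=` @open G ->
    hausdorff_group_topology s -> nbhs (0 : retopologize s) V ->
    opens s = @open G) ->
  topological_group_embedding f.
Proof.
move=> hA fI fC W0 WV minV; split=> //.
have fC0 (U : set A) : nbhs 0 U -> nbhs 0 (f @^-1` U).
  by move=> U0; apply: fC; rewrite raddf0.
have oF : opens (zero_filter_topology F) = @open G.
  apply: minV.
  - move=> U oU; apply/openP0 => x /oU[Q Q0 QU].
    by apply: filterS QU _; exact: fC0.
  - split; first exact: zero_filter_group_topology.
    apply: (@hausdorff_separated (zero_filter_group F)) => x xU.
    apply: fI; rewrite raddf0; apply: (separated_hausdorff hA) => U U0.
    by apply: (xU (f @^-1` U)); rewrite zero_filter_nbhs0; exists U.
  - by apply/(@nbhs_zero_filter G F); exists W => // x Wx /=; rewrite add0r;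
      exact: WV.
apply/seteqP; split=> [U|_ [U oU <-]]; last first.
  by move/continuousP : fC; exact.
rewrite -oF => oU.
(* This is the largest open set of A whose preimage is contained in U. *)
exists (\bigcup_(Q in [set Q | open Q /\ f @^-1` Q `<=` U]) Q).
  by apply: bigcup_open => Q [].
apply/seteqP; split=> [x [Q [_ QU] fxO]|x Ux]; first exact: QU.
have [Q Q0 QU] := oU _ Ux.
have : nbhs (f x) [set z | Q (z - f x)].
  apply/nbhs_translate; apply: filterS Q0 => z.
  by rewrite /= addrAC subrr add0r.
rewrite nbhsE => -[Q' [oQ Qx] QQ]; exists Q' => //; split=> // y /QQ Qy.
by have := QU (y - x); rewrite /= raddfB subrKC; apply.
Qed.

End InducedTopology.

(** * Evaluation at the continuous characters of G *)

Section CharacterMap.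
Variables (R : realType) (G : topologicalZmodType).

(** The classical structure allows finite sets of characters to be given as sequences with [\in]. *)
Definition character : choiceType :=
  {classic {chi : {additive G -> circle R} | continuous chi}}.

Definition character_fun (i : character) : {additive G -> circle R} := sval i.

Variable U : set G.

Definition polar : set character :=
  [set i | character_fun i @` U `<=` circle_plus R].

Definition char_map (x : G) : upower R polar := fun i => character_fun i x.

Fact char_mapB : {morph char_map : x y / x - y}.
Proof. by move=> x y; apply/funext => i; exact: raddfB. Qed.

HB.instance Definition _ :=
  GRing.isZmodMorphism.Build G (upower R polar) char_map char_mapB.

(** The polar of a neighbourhood is equicontinuous: all its characters send (1/n)U into (1/n)T_+.
    The finitely many characters of E are treated by their own continuity. *)
Lemma char_map_continuous : nbhs 0 U -> continuous char_map.
Proof.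
move=> U0; apply: additive_continuous => W /upower_nbhs0[n [E EW]].
have charC (i : character) :
    nbhs 0 [set x | nfrac n (circle_plus R) (character_fun i x)].
  have iC : continuous (character_fun i) by exact: svalP i.
  by apply: iC; rewrite raddf0; exact: circle_frac_nbhs0.
have nE : nbhs 0 [set x | forall i, i \in E ->
    nfrac n (circle_plus R) (character_fun i x)].
  apply: (@filter_seqI _ _ (nbhs (0 : G)) E
    (fun i x => nfrac n (circle_plus R) (character_fun i x))) => i _.
  exact: charC.
apply: (@filterS _ (nbhs (0 : G)) _ _ _ _ (filterI (nfrac_nbhs0 n U0) nE)).
move=> x [nx Ex].
apply: EW => i [Pi|iE]; last exact: Ex.
by move=> k kn; apply: Pi; exists (x *+ k); [exact: nx|exact: raddfMn].
Qed.

(** A point killed by every character cannot be separated from a quasi-convex set, as 0 is in T_+,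
    so it lies in every neighbourhood of 0. *)
Lemma char_map_injective :
  hausdorff_space G -> locally_quasi_convex R G -> injective char_map.
Proof.
move=> hG lqcG; apply: raddf_inj => x x0.
apply: (separated_hausdorff hG) => W /lqcG[V [V0 qcV VW]].
apply: VW; apply: contrapT => /qcV[chi [cchi chiV]]; apply.
rewrite (_ : chi x = 0); first exact: nbhs_singleton (circle_plus_nbhs0 R).
exact: (congr1 (fun g : upower R polar => g (exist _ chi cchi)) x0).
Qed.

Hypothesis qcU : quasi_convex R U.

(** This is the bipolar property. It serves both to recover U from the topology of [upower] and to
    show that U is stable under [kernel]. *)
Lemma quasi_convex_polar x :
  (forall i, polar i -> circle_plus R (char_map x i)) -> U x.
Proof.
move=> xP; apply: contrapT => /qcU[chi [cchi chiU]]; apply.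
exact: (xP (exist _ chi cchi)).
Qed.

(** This is N, the intersection of G with B. *)
Definition kernel : zmodClosed G :=
  preim_subgroup char_map (vanishing R polar).

Lemma kernelP x : x \in kernel -> forall i, polar i -> char_map x i = 0.
Proof. by move/vanishingP. Qed.

Lemma kernel_closed : nbhs 0 U -> closed [set` kernel].
Proof.
move=> U0; have /continuous_closedP/(_ _ (@vanishing_closed R _ polar)) :=
  char_map_continuous U0.
by [].
Qed.

Lemma kernelD x y : x \in kernel -> U y -> U (x + y).
Proof.
move=> /kernelP Kx Uy; apply: quasi_convex_polar => i Pi.
rewrite raddfD -[X in circle_plus R X]/(char_map x i + char_map y i).
rewrite Kx // add0r.
by apply: Pi; exists y.
Qed.

End CharacterMap.

(* G /\ B is taken inside G, along the embedding f. *)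
Theorem theorem6p12 (R : realType) (G : topologicalZmodType)
    (lqcG : locally_quasi_convex R G) (lminG : locally_minimal G) :
  exists (A : topologicalZmodType) (f : {additive G -> A}) (B : zmodClosed A),
    [/\ [/\ hausdorff_space A, complete_group A & locally_quasi_convex R A],
        topological_group_embedding f,
        compact [set` B] /\ UFSS (quotient_group B),
        minimal (subgroup_type (preim_subgroup f B)) &
        almost_minimal A].
Proof.
have [hG [V V0 minV]] := lminG; have [U [U0 qcU UV]] := lqcG V V0.
(* Local minimality passes to the smaller neighbourhood U, since V is an s-neighbourhood of 0
   whenever U is. *)
have minU (s : topology_on G) : opens s `<=` @open G ->
    hausdorff_group_topology s -> nbhs (0 : retopologize s) U ->
    opens s = @open G.
  by move=> sG gs sU; apply: minV => //; apply: filterS UV sU.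
pose P := @polar R G U.
exists (upower R P), (@char_map R G U : {additive G -> upower R P}).
exists (vanishing R P).
split.
- split; [exact: upower_hausdorff|exact: upower_complete|exact: upower_lqc].
(* With n = 1 and no extra index, the box is the set of functions sending P into T_+, and its
   preimage lies in U by the bipolar property. *)
- apply: (@locally_minimal_embedding G (upower R P) _ U
    (box 1 (P `|` [set` [::]]))) => //.
  + exact: upower_hausdorff.
  + exact: char_map_injective.
  + exact: char_map_continuous.
  + exact: box_nbhs0.
  + move=> x bx; apply: (quasi_convex_polar qcU) => i Pi.
    by have := bx i (or_introl Pi) 1 isT; rewrite mulr1n.
- by split; [exact: vanishing_compact|exact: upower_quotient_UFSS].
- apply: (minimal_subgroup (V := U)) => //; first exact: kernel_closed.
  exact: (kernelD qcU).
(* B itself is the required minimal subgroup, being compact and Hausdorff. *)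
- exists (vanishing R P); split.
  + exact: vanishing_closed.
  + apply: compact_minimal; last exact/subgroup_compact/vanishing_compact.
    exact/subgroup_hausdorff/upower_hausdorff.
  + exact: upower_quotient_UFSS.
Qed.
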